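(* Let $\mathbb{P}$ be the set of prime numbers and let $\mu$ be a Borel probability measure on $\mathbb{R}$. If $\mathbb{P}$ is a spectrum of $\mu$, i.e. if $E(\mathbb{P})=\{e^{2\pi i p x}:p\in\mathbb{P}\}$ is an orthonormal basis of $L^2(\mu)$, then $\mu$ is singular continuous.
   Context: $L^2(\mu)$ is the complex Hilbert space with inner product $\langle f,g\rangle=\int_{\mathbb{R}} f\overline{g}\,d\mu$. The family $E(\mathbb{P})$ is indexed by $\mathbb{P}$, with $e_p(x)=e^{2\pi i p x}$; ''orthonormal basis'' means that the family is orthonormal and has dense linear span. A measure $\mu$ on $\mathbb{R}$ is singular continuous if $\mu(\{x\})=0$ for every $x\in\mathbb{R}$ and $\mu$ is mutually singular with Lebesgue measure. *)

(* Defs.v *)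
From mathcomp Require Import all_boot all_order all_algebra.
From mathcomp Require Import all_classical all_reals all_analysis.
From mathcomp Require Import measurable_realfun complex.

Set Implicit Arguments.
Unset Strict Implicit.
Unset Printing Implicit Defensive.

Import Order.TTheory GRing.Theory Num.Theory.
Import numFieldNormedType.Exports.

Local Open Scope classical_set_scope.
Local Open Scope ring_scope.
Local Open Scope complex_scope.

Section ComplexL2.
Context d (T : measurableType d) (R : realType).
Variable mu : {measure set T -> \bar R}.

Definition cmeasurable_fun (f : T -> R[i]) : Prop :=
  measurable_fun [set: T] (fun x => complex.Re (f x)) /\
  measurable_fun [set: T] (fun x => complex.Im (f x)).

Definition cintegral (f : T -> R[i]) : R[i] :=
  (\int[mu]_x complex.Re (f x)) +i* (\int[mu]_x complex.Im (f x)).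

(* Elements of L^2(mu) are represented by functions; equality in L^2(mu) is
   equality mu-a.e., i.e. ||f - g||_2 = 0. *)
Definition inner (f g : T -> R[i]) : R[i] :=
  cintegral (fun x => f x * conjc (g x)).

(* Extended-real valued: finite exactly when |f|^2 is integrable. *)
Definition L2norm (f : T -> R[i]) : \bar R :=
  Lnorm mu 2%:E (fun x => (ComplexField.Normc.normc (f x))%:E).

Definition L2 : set (T -> R[i]) :=
  [set f | cmeasurable_fun f /\ (L2norm f < +oo)%E].

Section Families.
Variables (I : eqType) (D : set I) (e : I -> T -> R[i]).

Definition orthonormal_family : Prop :=
  (forall i, D i -> L2 (e i)) /\
  (forall i j, D i -> D j -> inner (e i) (e j) = (i == j)%:R).

Definition linear_span : set (T -> R[i]) :=
  [set g | exists (s : seq I) (c : I -> R[i]),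
     [set` s] `<=` D /\ g = (fun x => \sum_(i <- s) c i * e i x)].

Definition dense_span : Prop :=
  forall f, L2 f -> forall eps : R, 0 < eps ->
    exists2 g, linear_span g & (L2norm (fun x => f x - g x)%R < eps%:E)%E.

Definition orthonormal_basis : Prop := orthonormal_family /\ dense_span.

End Families.
End ComplexL2.

Definition mutually_singular d (T : measurableType d) (R : realType)
    (mu nu : {measure set T -> \bar R}) : Prop :=
  exists A : set T, [/\ measurable A, mu A = 0%E & nu (~` A) = 0%E].

Section RealLine.
Variable R : realType.

(* x |-> exp(2 i pi t x), by Euler's formula. *)
Definition character (t : R) (x : measurableTypeR R) : R[i] :=
  cos (2 * pi * t * x) +i* sin (2 * pi * t * x).

(* Membership in L^2, required by orthonormal_family, is automatic here. *)
Lemma character_L2 (mu : probability (measurableTypeR R) R) (t : R) :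
  L2 mu (character t).
Proof.
have mt : measurable_fun [set: measurableTypeR R]
    (fun x : measurableTypeR R => 2 * pi * t * x : measurableTypeR R).
  exact: mulrl_measurable.
split; first split => /=.
- apply: (measurableT_comp _ mt); apply: continuous_measurable_fun.
  exact: continuous_cos.
- apply: (measurableT_comp _ mt); apply: continuous_measurable_fun.
  exact: continuous_sin.
have -> : L2norm mu (character t) = Lnorm mu 2%:E (cst 1%E).
  rewrite /L2norm; congr (Lnorm mu _ _).
  by apply/funext => x /=; rewrite cos2Dsin2 sqrtr1.
rewrite Lnorm_cst1 [X in (X `^ _)%E](_ : _ = 1%E) ?poweR1e ?ltry //.
exact: (probability_setT mu).
Qed.

Definition spectrum (mu : {measure set (measurableTypeR R) -> \bar R})
    (L : set R) : Prop :=
  orthonormal_basis mu L character.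

Definition singular_continuous
    (mu : {measure set (measurableTypeR R) -> \bar R}) : Prop :=
  (forall x : R, mu [set x] = 0%E) /\ mutually_singular mu lebesgue_measure.

Definition primes_in : set R := [set p%:R | p in [set p : nat | prime p]].

End RealLine.
Arguments primes_in : clear implicits.

(* Main.v *)
(** An atom of mass m gives coefficients of modulus m against every character,
    which contradicts Bessel's inequality since there are infinitely many
    primes.

    If mu is not singular, some set B of positive mu-measure lies in an interval
    [-N, N] and carries a bounded density h of mu. The numbers
    c(n) = <1_B, e_n> are Fourier coefficients of h, hence square summable over
    the integers. Applying Parseval's identity for the basis (e_p), p prime, to
    1_B e_(-K) gives mu(B) = sum_p |c(p + K)|^2, a tail of that convergent
    series, which tends to 0 as K grows. *)

Require Import Defs.
From mathcomp Require Import all_boot all_order all_algebra.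
From mathcomp Require Import all_classical all_reals all_analysis.
From mathcomp Require Import measurable_realfun complex ring lra.

Set Implicit Arguments.
Unset Strict Implicit.
Unset Printing Implicit Defensive.

Import Order.TTheory GRing.Theory Num.Theory.
Import numFieldNormedType.Exports.

Local Open Scope classical_set_scope.
Local Open Scope ring_scope.
Local Open Scope complex_scope.

(** * Real and imaginary parts, and the squared modulus *)

Section ComplexNumbers.
Context {R : realType}.
Implicit Types z w : R[i].

Lemma ReD z w : complex.Re (z + w) = complex.Re z + complex.Re w.
Proof. by case: z w => [a b] [c d]. Qed.

Lemma ImD z w : complex.Im (z + w) = complex.Im z + complex.Im w.
Proof. by case: z w => [a b] [c d]. Qed.

Lemma ReM z w : complex.Re (z * w) =
  complex.Re z * complex.Re w - complex.Im z * complex.Im w.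
Proof. by case: z w => [a b] [c d]. Qed.

Lemma ImM z w : complex.Im (z * w) =
  complex.Re z * complex.Im w + complex.Im z * complex.Re w.
Proof. by case: z w => [a b] [c d]. Qed.

Lemma Re_sum (I : Type) (s : seq I) (F : I -> R[i]) :
  complex.Re (\sum_(i <- s) F i) = \sum_(i <- s) complex.Re (F i).
Proof. by apply: (big_morph _ ReD). Qed.

(** Real-valued, unlike the norm of [R[i]], and free of square roots, so that estimates on
    coefficients take place in [R] and are within reach of [ring] and [lra]. *)
Definition sqnormc z : R := complex.Re z ^+ 2 + complex.Im z ^+ 2.

Lemma sqnormc_ge0 z : 0 <= sqnormc z.
Proof. by rewrite addr_ge0 ?sqr_ge0. Qed.

Lemma sqnormcM z w : sqnormc (z * w) = sqnormc z * sqnormc w.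
Proof. by rewrite /sqnormc ReM ImM; ring. Qed.

Lemma sqnormcJ z : sqnormc (conjc z) = sqnormc z.
Proof. by case: z => a b; rewrite /sqnormc /= sqrrN. Qed.

Lemma mulc_conj z : z * conjc z = (sqnormc z)%:C.
Proof.
by case: z => a b; apply/eqP; rewrite eq_complex /sqnormc /=; apply/andP; split;
  apply/eqP; ring.
Qed.

Lemma normc_sqnormc z :
  ComplexField.Normc.normc z ^+ 2 = sqnormc z.
Proof. by case: z => a b; rewrite /= sqr_sqrtr // addr_ge0 ?sqr_ge0. Qed.

End ComplexNumbers.

(** * The inner product on bounded measurable functions over a finite measure *)

Section BoundedFunctions.
Context d (T : measurableType d) (R : realType).
Variable mu : {finite_measure set T -> \bar R}.
Implicit Types f g h u : T -> R[i].

(** Indicators, characters and their finite combinations all belong to this class. It is closed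
    under products, unlike [L2], and over a finite measure each member is integrable, so integrals
    split without further conditions. *)
Definition bounded_cmeasurable f := cmeasurable_fun f /\
  exists M : R, forall x, `|complex.Re (f x)| <= M /\ `|complex.Im (f x)| <= M.

Lemma bounded_cmeasurableD f g : bounded_cmeasurable f ->
  bounded_cmeasurable g -> bounded_cmeasurable (fun x => f x + g x).
Proof.
move=> [[mf1 mf2] [M HM]] [[mg1 mg2] [N HN]]; split.
  split; [under eq_fun do rewrite ReD|under eq_fun do rewrite ImD];
  exact: measurable_funD.
exists (M + N) => x; have [? ?] := HM x; have [? ?] := HN x.
rewrite ReD ImD; split; apply: le_trans (ler_normD _ _) _; exact: lerD.
Qed.

Lemma bounded_cmeasurable_cst (c : R[i]) : bounded_cmeasurable (cst c).
Proof.
split; first by split; exact: measurable_cst.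
exists (`|complex.Re c| + `|complex.Im c|) => x /=.
by rewrite lerDl lerDr !normr_ge0.
Qed.

Lemma bounded_cmeasurableM f g : bounded_cmeasurable f ->
  bounded_cmeasurable g -> bounded_cmeasurable (fun x => f x * g x).
Proof.
move=> [[mf1 mf2] [M HM]] [[mg1 mg2] [N HN]]; split.
  split; [under eq_fun do rewrite ReM|under eq_fun do rewrite ImM].
    by apply: measurable_funB; exact: measurable_funM.
  by apply: measurable_funD; exact: measurable_funM.
exists (M * N + M * N) => x; have [? ?] := HM x; have [? ?] := HN x.
rewrite ReM ImM; split.
  by apply: le_trans (ler_normB _ _) _; rewrite !normrM;
    apply: lerD; apply: ler_pM.
by apply: le_trans (ler_normD _ _) _; rewrite !normrM;
  apply: lerD; apply: ler_pM.
Qed.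

Lemma bounded_cmeasurableJ f : bounded_cmeasurable f ->
  bounded_cmeasurable (fun x => conjc (f x)).
Proof.
have ReJ z : complex.Re (conjc z) = complex.Re z :> R by case: z.
have ImJ z : complex.Im (conjc z) = - complex.Im z :> R by case: z.
move=> [[mf1 mf2] [M HM]]; split.
  split; [by under eq_fun do rewrite ReJ|under eq_fun do rewrite ImJ].
  exact: measurable_funN.
by exists M => x; rewrite ReJ ImJ normrN; exact: HM.
Qed.

Lemma bounded_cmeasurableN f : bounded_cmeasurable f ->
  bounded_cmeasurable (fun x => - f x).
Proof.
move=> bf; under eq_fun do rewrite -mulN1r.
exact: bounded_cmeasurableM (bounded_cmeasurable_cst _) bf.
Qed.

Lemma bounded_cmeasurable_sum (I : eqType) (s : seq I) (F : I -> T -> R[i]) :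
  (forall i, i \in s -> bounded_cmeasurable (F i)) ->
  bounded_cmeasurable (fun x => \sum_(i <- s) F i x).
Proof.
elim: s => [|i s IH] bF.
  under eq_fun do rewrite big_nil; exact: bounded_cmeasurable_cst.
under eq_fun do rewrite big_cons.
apply: bounded_cmeasurableD; first by apply: bF; rewrite mem_head.
by apply: IH => j js; apply: bF; rewrite in_cons js orbT.
Qed.

Lemma bounded_cmeasurable_integrable f : bounded_cmeasurable f ->
  mu.-integrable setT (EFin \o (fun x => complex.Re (f x))) /\
  mu.-integrable setT (EFin \o (fun x => complex.Im (f x))).
Proof.
move=> [[mf1 mf2] [M HM]].
have mufin : (mu setT < +oo)%E by rewrite ltey_eq fin_num_measure.
by split; apply: measurable_bounded_integrable => //; exists M; split;
  rewrite ?num_real // => N MN x _; have [h1 h2] := HM x;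
  apply: le_trans (ltW MN).
Qed.

Lemma cintegralD f g : bounded_cmeasurable f -> bounded_cmeasurable g ->
  cintegral mu (fun x => f x + g x) = cintegral mu f + cintegral mu g.
Proof.
move=> /bounded_cmeasurable_integrable[f1 f2].
move=> /bounded_cmeasurable_integrable[g1 g2].
rewrite /cintegral; apply/eqP; rewrite eq_complex /=; apply/andP; split;
  apply/eqP.
- by under eq_Rintegral do rewrite ReD; rewrite RintegralD.
- by under eq_Rintegral do rewrite ImD; rewrite RintegralD.
Qed.

Lemma cintegralZ (c : R[i]) f : bounded_cmeasurable f ->
  cintegral mu (fun x => c * f x) = c * cintegral mu f.
Proof.
move=> /bounded_cmeasurable_integrable[f1 f2].
have iZ (h : T -> R) (r : R) : mu.-integrable setT (EFin \o h) ->
    mu.-integrable setT (EFin \o (fun x => r * h x)).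
  exact: (@integrableZl _ _ _ mu setT measurableT r (EFin \o h)).
rewrite /cintegral; apply/eqP; rewrite eq_complex ReM ImM /=; apply/andP;
  split; apply/eqP.
- by under eq_Rintegral do rewrite ReM; rewrite RintegralB ?RintegralZl //;
  exact: iZ.
- by under eq_Rintegral do rewrite ImM; rewrite RintegralD ?RintegralZl //;
  exact: iZ.
Qed.

Lemma cintegralJ f : bounded_cmeasurable f ->
  cintegral mu (fun x => conjc (f x)) = conjc (cintegral mu f).
Proof.
move=> /bounded_cmeasurable_integrable[f1 f2].
rewrite /cintegral /=; congr (_ +i* _).
  by apply: eq_Rintegral => x _; case: (f x).
rewrite -mulN1r -RintegralZl //; apply: eq_Rintegral => x _.
by rewrite mulN1r; case: (f x).
Qed.

Lemma innerDl f g h : bounded_cmeasurable f -> bounded_cmeasurable g ->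
  bounded_cmeasurable h ->
  inner mu (fun x => f x + g x) h = inner mu f h + inner mu g h.
Proof.
move=> bf bg bh; rewrite /inner; under eq_fun do rewrite mulrDl.
by rewrite cintegralD //; apply: bounded_cmeasurableM => //;
  exact: bounded_cmeasurableJ.
Qed.

Lemma innerZl (c : R[i]) f h : bounded_cmeasurable f -> bounded_cmeasurable h ->
  inner mu (fun x => c * f x) h = c * inner mu f h.
Proof.
move=> bf bh; rewrite /inner; under eq_fun do rewrite -mulrA.
by rewrite cintegralZ //; apply: bounded_cmeasurableM => //;
  exact: bounded_cmeasurableJ.
Qed.

Lemma innerC f h : bounded_cmeasurable f -> bounded_cmeasurable h ->
  inner mu f h = conjc (inner mu h f).
Proof.
move=> bf bh; rewrite /inner -cintegralJ; last first.
  by apply: bounded_cmeasurableM => //; exact: bounded_cmeasurableJ.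
by congr cintegral; apply/funext => x; rewrite rmorphM /= conjcK mulrC.
Qed.

Lemma innerDr f g h : bounded_cmeasurable f -> bounded_cmeasurable g ->
  bounded_cmeasurable h ->
  inner mu h (fun x => f x + g x) = inner mu h f + inner mu h g.
Proof.
move=> bf bg bh; rewrite innerC //; last exact: bounded_cmeasurableD.
by rewrite innerDl // rmorphD (innerC bh bf) (innerC bh bg).
Qed.

Lemma innerZr (c : R[i]) f h : bounded_cmeasurable f -> bounded_cmeasurable h ->
  inner mu h (fun x => c * f x) = conjc c * inner mu h f.
Proof.
move=> bf bh; rewrite innerC //; last first.
  exact: bounded_cmeasurableM (bounded_cmeasurable_cst _) _.
by rewrite innerZl // rmorphM (innerC bh bf).
Qed.

Lemma inner_sumr (I : eqType) (s : seq I) (F : I -> T -> R[i]) h :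
  (forall i, i \in s -> bounded_cmeasurable (F i)) -> bounded_cmeasurable h ->
  inner mu h (fun x => \sum_(i <- s) F i x) = \sum_(i <- s) inner mu h (F i).
Proof.
move=> + bh; elim: s => [|i s IH] bF.
  rewrite big_nil /inner; under eq_fun do rewrite big_nil conjc0 mulr0.
  rewrite /cintegral; apply/eqP; rewrite eq_complex /=.
  by rewrite Rintegral_cst // mul0r eqxx.
rewrite big_cons -IH; last by move=> j js; apply: bF; rewrite in_cons js orbT.
under eq_fun do rewrite big_cons.
rewrite innerDr //; first by apply: bF; rewrite mem_head.
apply: bounded_cmeasurable_sum => j js; apply: bF.
by rewrite in_cons js orbT.
Qed.

(** The squared [L^2] norm as an element of [R]. Taking the real part loses nothing, since
    [f * conjc f] is real. *)
Definition energy f : R := complex.Re (inner mu f f).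

Lemma energyE f : energy f = \int[mu]_x sqnormc (f x).
Proof.
by rewrite /energy /inner /=; apply: eq_Rintegral => x _; rewrite mulc_conj.
Qed.

Lemma energy_ge0 f : 0 <= energy f.
Proof. by rewrite energyE; apply: Rintegral_ge0 => x _; exact: sqnormc_ge0. Qed.

Lemma energyB f g : bounded_cmeasurable f -> bounded_cmeasurable g ->
  energy (fun x => f x - g x) =
  energy f - complex.Re (inner mu f g) *+ 2 + energy g.
Proof.
move=> bf bg; have bN := bounded_cmeasurableN bg.
have bN1 := bounded_cmeasurableM (bounded_cmeasurable_cst (-1)) bg.
rewrite /energy; under eq_fun do rewrite -mulN1r.
rewrite innerDl ?innerDr ?innerZl ?innerZr //; last exact: bounded_cmeasurableD.
rewrite (innerC bg bf).
by case: (inner _ _ _) => a b; case: (inner _ _ _) => a' b';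
   case: (inner _ _ _) => a'' b''; rewrite /=; ring.
Qed.

(** * Finite orthonormal families: Pythagoras and Bessel *)

Section Orthonormal.
Variables (I : eqType) (e : I -> T -> R[i]) (s : seq I).
Hypothesis us : uniq s.
Hypothesis be : forall i, i \in s -> bounded_cmeasurable (e i).
Hypothesis oe : forall i j, i \in s -> j \in s ->
  inner mu (e i) (e j) = (i == j)%:R.

Lemma inner_lincomb u (a : I -> R[i]) : bounded_cmeasurable u ->
  inner mu u (fun x => \sum_(i <- s) a i * e i x) =
  \sum_(i <- s) conjc (a i) * inner mu u (e i).
Proof.
move=> bu; rewrite inner_sumr //; last first.
  move=> i is_; exact: bounded_cmeasurableM (bounded_cmeasurable_cst _)
    (be is_).
by apply: eq_big_seq => i is_; rewrite innerZr //; exact: be.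
Qed.

Lemma bounded_cmeasurable_lincomb (a : I -> R[i]) :
  bounded_cmeasurable (fun x => \sum_(i <- s) a i * e i x).
Proof.
apply: bounded_cmeasurable_sum => i is_.
exact: bounded_cmeasurableM (bounded_cmeasurable_cst _) (be is_).
Qed.

(** Pythagoras: orthonormality leaves only the diagonal terms of the double sum. *)
Lemma energy_lincomb (a : I -> R[i]) :
  energy (fun x => \sum_(i <- s) a i * e i x) = \sum_(i <- s) sqnormc (a i).
Proof.
have bl := bounded_cmeasurable_lincomb a.
rewrite /energy inner_lincomb // Re_sum; apply: eq_big_seq => i is_.
rewrite innerC //; last exact: be.
rewrite inner_lincomb; last exact: be.
rewrite (bigD1_seq i) //= oe // eqxx mulr1 big1_seq ?addr0; last first.
  move=> j /andP[ji js]; rewrite oe // eq_sym (negbTE ji) mulr0 //.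
by rewrite mulc_conj sqnormcJ.
Qed.

(** Expand the energy of the difference and use 2 Re(conj(a) c) <= |a|^2 + |c|^2 for each index. The
    coefficients [a] are arbitrary because density of the span provides some approximant, not the
    orthogonal projection. *)
Lemma le_energyB_lincomb u (a : I -> R[i]) : bounded_cmeasurable u ->
  energy u <= energy (fun x => u x - \sum_(i <- s) a i * e i x)
     + \sum_(i <- s) sqnormc (inner mu u (e i)).
Proof.
move=> bu; rewrite energyB //; last exact: bounded_cmeasurable_lincomb.
rewrite energy_lincomb inner_lincomb // Re_sum.
suff : \sum_(i <- s) complex.Re (conjc (a i) * inner mu u (e i)) *+ 2 <=
    \sum_(i <- s) sqnormc (a i) + \sum_(i <- s) sqnormc (inner mu u (e i)).
  by rewrite sumrMnl; lra.
rewrite -big_split; apply: ler_sum => i _.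
case: (a i) (inner _ _ _) => [x y] [x' y']; rewrite /sqnormc /= -subr_ge0.
(* The difference of the two sides is |a_i - c_i|^2, where c_i is the coefficient of [u]. *)
rewrite [leRHS](_ : _ = (x - x') ^+ 2 + (y - y') ^+ 2); last by ring.
by rewrite addr_ge0 ?sqr_ge0.
Qed.

(** The difference between [u] and its projection on the span has nonnegative energy, equal to
    [energy u] minus the sum of the squared coefficients. *)
Lemma bessel u : bounded_cmeasurable u ->
  \sum_(i <- s) sqnormc (inner mu u (e i)) <= energy u.
Proof.
move=> bu; pose a i := inner mu u (e i).
have := energy_ge0 (fun x => u x - \sum_(i <- s) a i * e i x).
rewrite energyB //; last exact: bounded_cmeasurable_lincomb.
rewrite energy_lincomb inner_lincomb // Re_sum.
under [X in X *+ 2]eq_bigr do rewrite mulrC mulc_conj /=.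
by rewrite mulr2n; set S := \sum_(i <- s) _; lra.
Qed.

End Orthonormal.

End BoundedFunctions.

(** * From the [L^2] norm to the energy, and Parseval up to epsilon *)

Section BoundedFunctionsTheory.
Context d (T : measurableType d) (R : realType).
Variable mu : {finite_measure set T -> \bar R}.
Implicit Types f g h u : T -> R[i].

Lemma EFin_energy f : bounded_cmeasurable f ->
  (energy mu f)%:E = (\int[mu]_x (sqnormc (f x))%:E)%E.
Proof.
move=> bf; rewrite energyE /Rintegral fineK //.
apply: integrable_fin_num => //.
have [i1 _] := bounded_cmeasurable_integrable mu
  (bounded_cmeasurableM bf (bounded_cmeasurableJ bf)).
by apply: eq_integrable i1 => // x _ /=; rewrite mulc_conj.
Qed.

(** Bridge between the extended-real norm in which density is stated and the real-valued energy used
    in the computations. *)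
Lemma L2norm_sq f : bounded_cmeasurable f ->
  (L2norm mu f `^ 2)%E = (energy mu f)%:E.
Proof.
move=> bf; rewrite /L2norm poweR_Lnorm // EFin_energy //.
apply: eq_integral => x _; rewrite -normc_sqnormc /= powR_mulrn //.
by rewrite real_normK // num_real.
Qed.

Lemma L2_bounded_cmeasurable f : bounded_cmeasurable f -> L2 mu f.
Proof.
move=> bf; split; first by case: bf.
apply: (@lty_poweRy _ _ 2) => //.
by rewrite L2norm_sq // ltry.
Qed.

Lemma energy_le_L2norm f (eps : R) : bounded_cmeasurable f ->
  (L2norm mu f < eps%:E)%E -> energy mu f <= eps ^+ 2.
Proof.
move=> bf feps; have N0 : (0 <= L2norm mu f)%E by exact: Lnorm_ge0.
have eps0 : 0 <= eps by rewrite -lee_fin (le_trans N0) // ltW.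
rewrite -lee_fin -L2norm_sq // -powR_mulrn // -poweR_EFin.
by apply: gt0_ler_poweR; rewrite ?in_itv /= ?lee_fin ?N0 ?leey ?eps0 // ltW.
Qed.

(** [linear_span] allows repeated indices, whereas the orthonormal expansions need a duplicate-free
    list; repetitions are absorbed into the coefficients as multiplicities. *)
Lemma lincomb_undup (I : eqType) (s : seq I) (c : I -> R[i])
    (e : I -> T -> R[i]) x :
  \sum_(i <- s) c i * e i x =
  \sum_(i <- undup s) (c i *+ count_mem i s) * e i x.
Proof.
rewrite -(big_undup_iterop_count _ s xpredT (fun i => c i * e i x)) /=.
by apply: eq_bigr => i _; rewrite mulrnAl.
Qed.

(** The half of Parseval's identity that comes from density: a combination close to [u] loses at
    most [eps] of its energy, and [le_energyB_lincomb] replaces its coefficients by those of [u]. *)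
Lemma orthonormal_basis_energy_le (I : eqType) (D : set I)
    (e : I -> T -> R[i]) u (eps : R) :
  orthonormal_basis mu D e -> (forall i, D i -> bounded_cmeasurable (e i)) ->
  bounded_cmeasurable u -> 0 < eps ->
  exists s : seq I, [/\ uniq s, [set` s] `<=` D &
    energy mu u <= eps + \sum_(i <- s) sqnormc (inner mu u (e i))].
Proof.
move=> [[_ oe] De] be bu eps0.
(* Density controls the norm, whose square is the energy; hence the square root. *)
have seps0 : 0 < Num.sqrt eps by rewrite sqrtr_gt0.
have [g [s [c [sD ->]]] ug] := De u (L2_bounded_cmeasurable bu) _ seps0.
have undupD i : i \in undup s -> D i.
  by rewrite mem_undup => /sD.
exists (undup s); split => //; first exact: undup_uniq.
have bs i : i \in undup s -> bounded_cmeasurable (e i) by move=> /undupD /be.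
pose a i := c i *+ count_mem i s.
apply: le_trans (le_energyB_lincomb (undup_uniq s) bs _ a bu) _.
  by move=> i j /undupD Di /undupD Dj; exact: oe.
rewrite lerD2r -[leRHS](sqr_sqrtr (ltW eps0)).
apply: energy_le_L2norm.
  by apply: bounded_cmeasurableD => //; apply: bounded_cmeasurableN;
    exact: bounded_cmeasurable_lincomb.
by under [X in L2norm _ X]eq_fun do rewrite -lincomb_undup.
Qed.

End BoundedFunctionsTheory.

(** * Indicator functions as elements of [L^2] *)

Section Indicator.
Context d (T : measurableType d) (R : realType).
Variable mu : {finite_measure set T -> \bar R}.
Implicit Types (B : set T) (f u : T -> R[i]).

Definition cindic B (x : T) : R[i] := (\1_B x)%:C.

Lemma bounded_cmeasurable_cindic B : measurable B ->
  bounded_cmeasurable (cindic B).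
Proof.
move=> mB; split; first by split => /=;
  [exact: measurable_indic|exact: measurable_cst].
exists 1 => x /=; rewrite normr0 ler01; split => //.
by rewrite indicE; case: (x \in B); rewrite ?normr1 ?normr0.
Qed.

Lemma cindic_idem B x : cindic B x * cindic B x = cindic B x.
Proof.
by rewrite /cindic -rmorphM /= indicE; case: (x \in B); rewrite ?mulr1 ?mulr0.
Qed.

Lemma cindicJ B x : conjc (cindic B x) = cindic B x.
Proof. exact: conjc_real. Qed.

Lemma sqnormc_cindic B x : sqnormc (cindic B x) = \1_B x :> R.
Proof.
by rewrite /sqnormc /= indicE; case: (x \in B);
  rewrite ?expr1n ?expr0n /= addr0.
Qed.

Lemma inner_cindicM B f : measurable B -> bounded_cmeasurable f ->
  inner mu (cindic B) (fun x => cindic B x * f x) = inner mu (cindic B) f.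
Proof.
move=> mB bf; rewrite /inner; congr cintegral; apply/funext => x.
by rewrite rmorphM mulrA -[in RHS]cindic_idem; congr (_ * _ * _);
  exact: cindicJ.
Qed.

Lemma energy_cindic B : measurable B -> energy mu (cindic B) = fine (mu B).
Proof.
move=> mB; rewrite energyE; under eq_Rintegral do rewrite sqnormc_cindic.
by rewrite /Rintegral integral_indic // setIT.
Qed.

Lemma EFin_energy_cindicM B f : measurable B -> bounded_cmeasurable f ->
  (energy mu (fun x => cindic B x * f x))%:E =
  (\int[mu]_(x in B) (sqnormc (f x))%:E)%E.
Proof.
move=> mB bf; rewrite EFin_energy; last first.
  exact: bounded_cmeasurableM (bounded_cmeasurable_cindic mB) bf.
rewrite [RHS]integral_mkcond; apply: eq_integral => x _.
rewrite sqnormcM sqnormc_cindic patchE indicE.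
by case: (x \in B); rewrite ?mul1r ?mul0r.
Qed.

End Indicator.
Arguments cindic {d T R} B x.

(** Summability is expressed by finite duplicate-free lists, as in the spans. Some list [s0] has a
    sum within [eps] of the supremum; a list disjoint from [s0] can then add at most [eps]. *)
Lemma small_tail (R : realType) (a : nat -> R) (C : R) :
  (forall n, 0 <= a n) ->
  (forall s : seq nat, uniq s -> \sum_(i <- s) a i <= C) ->
  forall eps, 0 < eps -> exists K : nat, forall s : seq nat, uniq s ->
    (forall i, i \in s -> (K <= i)%N) -> \sum_(i <- s) a i <= eps.
Proof.
move=> a0 aC eps eps0.
pose A := [set x | exists2 s : seq nat, uniq s & x = \sum_(i <- s) a i].
have supA : has_sup A.
  by split; [exists 0, [::]; rewrite ?big_nil|exists C => _ [s us ->];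
    exact: aC].
have [_ [s0 us0 ->] hs0] := sup_adherent eps0 supA.
(* This [K] exceeds every index of [s0], so [s0 ++ s] is still duplicate-free. *)
exists (\max_(i <- s0) i).+1 => s us Ks.
have : \sum_(i <- s0 ++ s) a i <= sup A.
  apply: sup_upper_bound => //; exists (s0 ++ s) => //.
  rewrite cat_uniq us0 us andbT /=; apply/hasPn => i /Ks; apply: contraL => is0.
  by rewrite -leqNgt; exact: (@leq_bigmax_seq _ _ _ id).
by rewrite big_cat /=; lra.
Qed.

(** * Algebra of the characters *)

Section Characters.
Context {R : realType}.
Implicit Types (s t : R) (x : measurableTypeR R).

Lemma bounded_cmeasurable_character t : bounded_cmeasurable (character t).
Proof.
have mt : measurable_fun [set: measurableTypeR R]
    (fun x : measurableTypeR R => 2 * pi * t * x : measurableTypeR R).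
  exact: mulrl_measurable.
split; first split => /=.
- apply: (measurableT_comp _ mt); apply: continuous_measurable_fun.
  exact: continuous_cos.
- apply: (measurableT_comp _ mt); apply: continuous_measurable_fun.
  exact: continuous_sin.
by exists 1 => x /=; rewrite !ler_norml cos_geN1 cos_le1 sin_geN1 sin_le1.
Qed.

Lemma characterB s t x : character s x * conjc (character t x) =
  character (s - t) x.
Proof.
rewrite [RHS](_ : _ = cos (2 * pi * s * x - 2 * pi * t * x) +i*
                      sin (2 * pi * s * x - 2 * pi * t * x)); last first.
  by congr (cos _ +i* sin _); rewrite !mulrBr mulrBl.
by apply/eqP; rewrite eq_complex /= cosB sinB; apply/andP; split; apply/eqP;
  ring.
Qed.

Lemma character0 x : character 0 x = 1 :> R[i].
Proof. by rewrite /character mulr0 mul0r cos0 sin0. Qed.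

Lemma characterN t x : character (- t) x = conjc (character t x).
Proof.
by rewrite -[in RHS](mul1r (conjc _)) -(character0 x) characterB sub0r.
Qed.

Lemma characterDJ s t x :
  conjc (character (s + t) x) = conjc (character s x) * conjc (character t x).
Proof. by rewrite -(characterN s) characterB -opprD characterN. Qed.

Lemma sqnormc_character t x : sqnormc (character t x) = 1 :> R.
Proof. by rewrite /sqnormc /= cos2Dsin2. Qed.

End Characters.

(** * Consequences of having the primes as a spectrum *)

Section Spectrum.
Context {R : realType}.
Variable mu : probability (measurableTypeR R) R.

(** Frequencies are real numbers in [spectrum]; natural indices are recovered here so that
    [small_tail] applies. *)
Lemma primes_inP (s : seq R) : [set` s] `<=` primes_in R ->
  exists2 s' : seq nat, all prime s' & s = [seq n%:R | n <- s'].
Proof.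
elim: s => [|x s IH] sP; first by exists [::].
have [p /= pp px] : primes_in R x by apply: sP; rewrite /= mem_head.
have [|s' ps' ->] := IH; first by move=> y ys; apply: sP;
  rewrite /= in_cons ys orbT.
by exists (p :: s'); rewrite /= ?pp // px.
Qed.

Lemma spectrum_primes_atomless :
  spectrum mu (primes_in R) -> forall x, mu [set x] = 0%E.
Proof.
move=> [[_ oe] _] x.
have mx : measurable [set x : measurableTypeR R] by exact: measurable_set1.
pose m := fine (mu [set x]).
have muE : mu [set x] = m%:E by rewrite fineK // fin_num_measure.
rewrite muE; congr EFin; apply/eqP; apply: contraT => m_neq0.
have m_gt0 : 0 < m by rewrite lt_def m_neq0 -lee_fin -muE measure_ge0.
(* Only the value of the character at [x] matters: the coefficient is its conjugate times [m], and
   that value has modulus 1. *)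
have coef t : sqnormc (inner mu (cindic [set x]) (character t)) = m ^+ 2.
  have -> : inner mu (cindic [set x]) (character t) =
      conjc (character t x) * inner mu (cindic [set x]) (cst 1).
    rewrite -innerZr; [|exact: bounded_cmeasurable_cst|
      exact: bounded_cmeasurable_cindic].
    congr cintegral; apply/funext => y; rewrite /cindic indicE.
    have [/set_mem ->|_] := boolP (y \in _); last by rewrite !mul0r.
    by rewrite /cst mulr1.
  rewrite sqnormcM sqnormcJ sqnormc_character mul1r.
  have -> : inner mu (cindic [set x]) (cst 1) = m%:C.
    rewrite /inner /cintegral /=; apply/eqP; rewrite eq_complex /=.
    rewrite (_ : (fun y => _) = \1_[set x]); last first.
      by apply/funext => y /=; rewrite mulr1 oppr0 mulr0 subr0.
    rewrite (_ : (fun y => _) = cst 0); last first.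
      by apply/funext => y /=; rewrite oppr0 mulr0 mul0r addr0.
    by rewrite Rintegral_cst // mul0r eqxx /Rintegral integral_indic //
      setIT eqxx.
  by rewrite /sqnormc /= expr0n addr0.
(* Extended by 0 off the primes, to give a sequence on all of [nat]. *)
pose a (n : nat) := if prime n then m ^+ 2 else 0.
have a0 n : 0 <= a n by rewrite /a; case: ifP; rewrite ?sqr_ge0.
have aC (s : seq nat) : uniq s -> \sum_(n <- s) a n <= m.
  move=> us; rewrite -big_mkcond -big_filter.
  have -> : \sum_(n <- [seq n <- s | prime n]) m ^+ 2 =
    \sum_(n <- [seq n <- s | prime n])
      sqnormc (inner mu (cindic [set x]) (character n%:R)).
    by apply: eq_bigr => n _; rewrite coef.
  rewrite -[leRHS]energy_cindic //; apply: bessel => //.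
  - exact: filter_uniq.
  - move=> i _; exact: bounded_cmeasurable_character.
  - move=> i j; rewrite !mem_filter => /andP[pi _] /andP[pj _].
    by rewrite oe ?eqr_nat //; [exists i|exists j].
  - exact: bounded_cmeasurable_cindic.
(* A single prime beyond [K] contributes [m ^+ 2], which already exceeds this bound on the tail. *)
have m2 : 0 < m ^+ 2 / 2 by rewrite divr_gt0 // exprn_gt0.
have [K tailK] := small_tail a0 aC m2.
have [p Kp pp] := prime_above K.
have := tailK [:: p] isT.
rewrite big_seq1 /a pp => /(_ _)/wrap[i|]; last by lra.
by rewrite inE => /eqP ->; exact: ltnW.
Qed.

(** Domination, stated through energies, says that [mu] on [B] is at most [C] times [nu]. It
    transfers orthonormality in [L^2(nu)] into a Bessel bound for the coefficients of [1_B] in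
    [L^2(mu)] at all natural frequencies, not only at primes. *)
Lemma spectrum_primes_null_of_dominated
    (nu : {finite_measure set (measurableTypeR R) -> \bar R})
    (B : set (measurableTypeR R)) (C : R) :
  spectrum mu (primes_in R) -> measurable B -> 0 < C ->
  (forall f : measurableTypeR R -> R[i], bounded_cmeasurable f ->
    energy mu (fun x => cindic B x * f x) <= C * energy nu f) ->
  (forall m n : nat, inner nu (character m%:R) (character n%:R) =
    (m == n)%:R) ->
  mu B = 0%E.
Proof.
move=> specP mB C0 domB onu.
pose c t := inner mu (cindic B) (character t).
have b1 := bounded_cmeasurable_cindic R mB.
have be := @bounded_cmeasurable_character R.
pose m := fine (mu B).
have muE : mu B = m%:E by rewrite fineK // fin_num_measure.
have bess (s : seq nat) : uniq s -> \sum_(n <- s) sqnormc (c n%:R) <= C * m.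
  (* Expand ||1_B - 1_B f||^2 >= 0, with f = C^-1 sum_(n <- s) c_n e_n. *)
  move=> us; set S := \sum_(n <- s) _.
  (* For coefficients t c_n the expansion is at most m - 2 t S + C t^2 S; the choice t = 1/C
     minimises this and yields S <= C m. *)
  pose a (n : nat) := C^-1%:C * c n%:R.
  pose f x := \sum_(n <- s) a n * character n%:R x.
  have bs (n : nat) : n \in s -> bounded_cmeasurable (@character R n%:R) by [].
  have bf : bounded_cmeasurable f by exact: bounded_cmeasurable_lincomb.
  have := energy_ge0 mu (fun x => cindic B x - cindic B x * f x).
  rewrite energyB //; last exact: bounded_cmeasurableM.
  rewrite energy_cindic // -/m inner_cindicM // inner_lincomb // Re_sum.
  have -> : \sum_(n <- s) complex.Re (conjc (a n) * inner mu (cindic B)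
    (character n%:R)) = C^-1 * S.
    rewrite mulr_sumr; apply: eq_bigr => n _.
    rewrite /a -/(c n%:R); case: (c n%:R) => p q.
    by rewrite /sqnormc /=; ring.
  have := domB f bf.
  rewrite energy_lincomb //.
  have -> : \sum_(n <- s) sqnormc (a n) = C^-1 ^+ 2 * S.
    rewrite mulr_sumr; apply: eq_bigr => n _.
    by rewrite /a sqnormcM {1}/sqnormc /= expr0n addr0.
  rewrite expr2 !mulrA divff ?gt_eqF // mul1r => le1 ge0.
  rewrite -ler_pdivrMl //; move: le1 ge0; rewrite mulr2n; lra.
suff m0 eps : 0 < eps -> m <= eps.
  rewrite muE; congr EFin; apply/eqP; rewrite eq_le.
  rewrite -[0 <= m]lee_fin -muE measure_ge0 andbT.
  by apply/ler_addgt0Pl => e e0; rewrite addr0; exact: m0.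
move=> eps0.
(* One half pays for the approximation of [u] in the basis, the other for the tail. *)
have eps2 : 0 < eps / 2 by rewrite divr_gt0.
have [K tailK] := small_tail (fun n => sqnormc_ge0 (c n%:R)) bess eps2.
(* The factor has modulus 1, so the energy stays [m], while the coefficient of [u] at a prime p is
   that of [1_B] at K + p, beyond the threshold. *)
pose u x := cindic B x * conjc (character K%:R x).
have bu : bounded_cmeasurable u.
  by apply: bounded_cmeasurableM => //; exact: bounded_cmeasurableJ.
have [s [us sP]] := orthonormal_basis_energy_le specP (fun t _ => be t) bu eps2.
have -> : energy mu u = m.
  rewrite /m -energy_cindic // !energyE; apply: eq_Rintegral => x _.
  by rewrite sqnormcM sqnormcJ sqnormc_character mulr1.
move=> h; apply: le_trans h _; rewrite [leRHS](splitr eps) lerD2l.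
have [s' _ s'E] := primes_inP sP.
have -> : \sum_(t <- s) sqnormc (inner mu u (character t)) =
    \sum_(n <- [seq (K + i)%N | i <- s']) sqnormc (c n%:R).
  rewrite s'E !big_map; apply: eq_bigr => n _; congr sqnormc.
  rewrite /c /inner; congr cintegral; apply/funext => x.
  rewrite /u -mulrA; congr (_ * _).
  by rewrite natrD; apply/esym; exact: characterDJ.
apply: tailK.
  rewrite map_inj_uniq; last exact: addnI.
  by move: us; rewrite s'E => /map_uniq.
by move=> _ /mapP[j _ ->]; exact: leq_addr.
Qed.

End Spectrum.

(** * Orthonormality of characters for the uniform law on a symmetric interval *)

Section UniformCharacters.
Context {R : realType}.

Lemma sin_natpi (k : nat) : sin (pi *+ k) = 0 :> R.
Proof.
by elim: k => [|k IH]; rewrite ?mulr0n ?sin0 // mulrS sinD sinpi IH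
  mul0r mulr0 addr0.
Qed.

Lemma sin_2pi_natB (m n k : nat) : sin (2 * pi * (m%:R - n%:R) * k%:R) = 0 :> R.
Proof.
(* Natural subtraction truncates, so this covers only [j <= i]; the other case follows because sine
   is odd. *)
have natE (i j : nat) : (j <= i)%N ->
    2 * pi * (i%:R - j%:R) * k%:R = pi *+ (2 * (i - j) * k) :> R.
  move=> ji; rewrite -natrB //.
  by rewrite -[RHS]mulr_natl natrM natrM; move: (_%:R) (k%:R) => p q; ring.
have [nm|mn] := leqP n m; first by rewrite natE // sin_natpi.
have -> : 2 * pi * (m%:R - n%:R) * k%:R =
  - (2 * pi * (n%:R - m%:R) * k%:R) :> R.
  by rewrite -[m%:R - _]opprB mulrN mulNr.
by rewrite sinN (natE n m (ltnW mn)) sin_natpi oppr0.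
Qed.

(** The uniform law is normalised Lebesgue measure on the interval, so the fundamental theorem of
    calculus applies. *)
Lemma Rintegral_uniform_derive (a b : R) (ab : a < b) (f F : R -> R) :
  continuous f -> (forall x, 0 <= f x) ->
  (forall x : R, is_derive x (1 : R) F (f x)) ->
  \int[uniform_prob ab]_x f x = (b - a)^-1 * (F b - F a).
Proof.
move=> cf f0 dF.
have cF : continuous F.
  move=> x; apply: differentiable_continuous; apply/derivable1_diffP.
  exact: ex_derive.
rewrite /Rintegral integral_uniform.
- rewrite (@continuous_FTC2 _ f F) //.
  + exact: continuous_subspaceT.
  + split; first by move=> x _; exact: ex_derive.
      by apply: cvg_at_right_filter; exact: cF.
    by apply: cvg_at_left_filter; exact: cF.
  + by move=> x _; rewrite derive1E; exact: derive_val.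
- by apply/measurable_EFinP; exact: continuous_measurable_fun.
- by move=> x; rewrite lee_fin.
Qed.

(** The interval has integer endpoints, hence contains a whole number of periods of the character of
    frequency [m - n], whose mean vanishes unless [m = n]. *)
Lemma inner_uniform_character (N : nat) (NN : - N.+1%:R < N.+1%:R :> R)
    (m n : nat) :
  inner (uniform_prob NN) (character m%:R) (character n%:R) = (m == n)%:R.
Proof.
set P := uniform_prob NN.
have -> : inner P (character m%:R) (character n%:R) =
  cintegral P (character (m%:R - n%:R)).
  by congr cintegral; apply/funext => x; exact: characterB.
have one : \int[P]_x (1 : R) = 1.
  by rewrite Rintegral_cst // mul1r;
    exact: (congr1 fine (@probability_setT _ _ _ (uniform_prob NN))).
have [->|mn] := eqVneq m n.
  rewrite subrr /cintegral (_ : character 0 = cst 1);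
    last by apply/funext => x; exact: character0.
  by rewrite one Rintegral_cst // mul0r.
pose t : R := m%:R - n%:R.
pose a : R := 2 * pi * t.
have t0 : t != 0 by rewrite subr_eq0 eqr_nat.
have a0 : a != 0 by rewrite !mulf_neq0 // gt_eqF // pi_gt0.
have sinaN : sin (a * N.+1%:R) = 0.
  exact: sin_2pi_natB.
have [iR iI] := bounded_cmeasurable_integrable P
  (bounded_cmeasurable_character t).
have i1 : P.-integrable setT (EFin \o cst (1 : R)).
  exact: (bounded_cmeasurable_integrable P (bounded_cmeasurable_cst _ 1)).1.
have da x : is_derive x (1 : R) (fun x : R => a * x) a.
  have := is_deriveZ a (is_derive_id x (1 : R)).
  by rewrite [a *: _]mulr1.
have ca : continuous (fun x : R => a * x).
  by move=> x; apply: differentiable_continuous; apply/derivable1_diffP;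
    exact: ex_derive.
(* [integral_uniform] needs a nonnegative integrand, hence the added 1. *)
have intcos : \int[P]_x (1 + cos (a * x)) = 1.
  have dF (x : R) : is_derive x (1 : R)
      (fun x => x + a^-1 * sin (a * x)) (1 + cos (a * x)).
    have := is_deriveD (is_derive_id x 1) (is_deriveZ a^-1 (is_derive1_comp
      (is_derive_sin (a * x)) (da x))).
    by rewrite [_ *: _]mulrCA mulVf // mulr1.
  rewrite (Rintegral_uniform_derive NN _ _ dF).
  (* Both boundary sines vanish, as the endpoints are integers. *)
  - rewrite mulrN sinN sinaN.
    rewrite oppr0 mulr0 !addr0 mulVf // gt_eqF // subr_gt0 //.
  - move=> x; apply: cvgD; first exact: cvg_cst.
    by apply: continuous_comp; [exact: ca|exact: continuous_cos].
  - by move=> x; rewrite -lerBlDl sub0r cos_geN1.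
have intsin : \int[P]_x (1 + sin (a * x)) = 1.
  have dF (x : R) : is_derive x (1 : R)
      (fun x => x - a^-1 * cos (a * x)) (1 + sin (a * x)).
    have := is_deriveB (is_derive_id x 1) (is_deriveZ a^-1 (is_derive1_comp
      (is_derive_cos (a * x)) (da x))).
    by rewrite [_ *: _]mulrCA mulVf // mulr1 opprK.
  rewrite (Rintegral_uniform_derive NN _ _ dF).
  (* Here the boundary terms cancel because cosine is even and the interval symmetric. *)
  - rewrite mulrN cosN opprD addrACA subrr addr0.
    rewrite mulVf // gt_eqF // subr_gt0 //.
  - move=> x; apply: cvgD; first exact: cvg_cst.
    by apply: continuous_comp; [exact: ca|exact: continuous_sin].
  - by move=> x; rewrite -lerBlDl sub0r sin_geN1.
rewrite (_ : false%:R = 0) // /cintegral; apply/eqP; rewrite eq_complex /=;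
  apply/andP; split; apply/eqP.
- by move: intcos; rewrite RintegralD // one => /eqP;
  rewrite -subr_eq0 addrAC subrr add0r => /eqP.
- by move: intsin; rewrite RintegralD // one => /eqP;
  rewrite -subr_eq0 addrAC subrr add0r => /eqP.
Qed.

End UniformCharacters.

(** * Splitting off the singular part by exhaustion *)

Section LebesgueDecomposition.
Local Open Scope ereal_scope.
Context d (T : measurableType d) (R : realType).
Variables (mu : {finite_measure set T -> \bar R})
          (nu : {measure set T -> \bar R}).

(** [N] is a union of [nu]-null sets whose [mu]-measures approach the supremum over all null sets. A
    null set outside [N] with positive [mu]-measure would push past that supremum. Hence [mu]
    restricted to the complement of [N] is absolutely continuous with respect to [nu]. *)
Lemma ex_maximal_null_set : exists N : set T, [/\ measurable N, nu N = 0 &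
  forall A, measurable A -> nu A = 0 -> A `<=` ~` N -> mu A = 0].
Proof.
pose null := [set A : set T | measurable A /\ nu A = 0].
pose S : set R := [set fine (mu A) | A in null].
have muE A : measurable A -> mu A = (fine (mu A))%:E.
  by move=> mA; rewrite fineK // fin_num_measure.
have supS : has_sup S.
  split; first by exists (fine (mu set0)), set0.
  exists (fine (mu setT)) => _ [A [mA _] <-].
  by rewrite -lee_fin -!muE // le_measure ?inE.
have /choice[E EP] : forall n : nat,
    exists A, null A /\ (sup S - n.+1%:R^-1 < fine (mu A))%R.
  move=> n; have n0 : (0 < n.+1%:R^-1 :> R)%R by [].
  by have [_ [A nA <-] h] := sup_adherent n0 supS; exists A.
pose N := \bigcup_n E n.
have mN : measurable N by apply: bigcup_measurable => n _; have [[]] := EP n.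
have nuN : nu N = 0.
  apply: measure_negligible => //; apply: negligible_bigcup => n.
  by have [[mE nE] _] := EP n; apply/negligibleP.
exists N; split => // A mA nuA AN.
rewrite muE //; congr EFin; apply/eqP;
  rewrite eq_le -[(0 <= _)%R]lee_fin -muE //.
rewrite measure_ge0 andbT leNgt; apply/negP => A0.
(* [E n] misses the supremum by less than 1/(n+1), so adding the disjoint set [A] of larger measure
   overshoots it. *)
have [n nA] : exists n : nat, (n.+1%:R^-1 < fine (mu A))%R.
  by have [n] := ltr_add_invr A0; rewrite add0r => nA; exists n.
have [[mE nE] lt] := EP n.
have : S (fine (mu (E n `|` A))).
  exists (E n `|` A) => //; split; first exact: measurableU.
  apply: measure_negligible; first exact: measurableU.
  by apply: negligibleU; apply/negligibleP.
move=> /(sup_upper_bound supS).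
rewrite measureU //; last first.
  by rewrite -subset0 => x [En Ax]; apply: (AN x Ax); exists n.
rewrite fineD ?fin_num_measure //.
by have := ltrD lt nA; rewrite subrK ltNge => /negP.
Qed.

End LebesgueDecomposition.

(** * Singularity with respect to Lebesgue measure *)

Section Main.
Context {R : realType}.
Variable mu : probability (measurableTypeR R) R.

(** The complement of the maximal null set [N] carries the absolutely continuous part of [mu]. It is
    cut into countably many pieces on which position and density are bounded, and each piece is
    [mu]-null by the domination criterion. *)
Lemma spectrum_primes_singular :
  spectrum mu (primes_in R) -> mutually_singular mu (@lebesgue_measure R).
Proof.
move=> specP.
pose leb : {sigma_finite_measure set (measurableTypeR R) -> \bar R} :=
  @lebesgue_measure R.
have [N [mN lebN muN]] := ex_maximal_null_set mu leb.
have mCN := measurableC mN.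
exists (~` N); split; rewrite ?setCK //.
have CNfin : (mu (~` N) < +oo)%E by rewrite ltey_eq fin_num_measure.
(* The absolutely continuous part: [kappa A] is [mu] of the trace of [A] on the complement of
   [N]. *)
pose kappa : {finite_measure set (measurableTypeR R) -> \bar R} :=
  mfrestr mCN CNfin.
have kappaE A : A `<=` ~` N -> kappa A = mu A.
  by move=> AN; rewrite /kappa /= /mfrestr /mrestr setIidl.
have kleb : kappa `<< leb.
  apply/null_content_dominatesP => A mA lA.
  rewrite /kappa /= /mfrestr /mrestr; apply: muN; first exact: measurableI.
    apply/eqP; rewrite -measure_le0 -lA le_measure ?inE //; exact: measurableI.
  exact: subIsetr.
pose f := Radon_Nikodym_SigmaFinite.f kappa leb.
have f0 x : (0 <= f x)%E := Radon_Nikodym_SigmaFinite.f_ge0 kleb x.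
have ffin x : f x \is a fin_num := Radon_Nikodym_SigmaFinite.f_fin_num kleb x.
have mf : measurable_fun setT f := measurable_int _
  (Radon_Nikodym_SigmaFinite.f_integrable kleb).
pose I (n : nat) : set (measurableTypeR R) := `[- n.+1%:R, n.+1%:R]%classic.
pose F (n : nat) := [set x | (f x <= n.+1%:R%:E)%E].
pose B n := ~` N `&` (I n `&` F n).
have mI n : measurable (I n) by exact: measurable_itv.
have mF n : measurable (F n).
  by rewrite -[F n]setTI; exact: emeasurable_fun_infty_c.
have mB n : measurable (B n) by apply: measurableI => //; exact: measurableI.
have CN_B : ~` N = \bigcup_n B n.
  rewrite -setI_bigcupr (_ : \bigcup_n _ = setT) ?setIT //.
  (* The density is finite everywhere, so one integer above |x| + f(x) puts [x] in both [I n] and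
     [F n]. *)
  rewrite -subTset => x _; pose y := `|x| + fine (f x).
  have fx0 : 0 <= fine (f x) by exact/fine_ge0/f0.
  have /archi_boundP/ltW : 0 <= y by rewrite addr_ge0.
  set n := Num.bound y => yn.
  have {}yn : y <= n.+1%:R by rewrite (le_trans yn) // ler_nat.
  exists n => //; split.
    by rewrite /I /= in_itv /= -ler_norml (le_trans _ yn) // lerDl.
  have fE : f x = (fine (f x))%:E by rewrite fineK.
  by rewrite /F /= fE lee_fin (le_trans _ yn) // lerDr.
rewrite CN_B; apply: measure_negligible; first exact: bigcup_measurable.
apply: negligible_bigcup => n; apply/negligibleP => //.
have NN : - n.+1%:R < n.+1%:R :> R by rewrite -subr_gt0 opprK addr_gt0.
(* The bound on the density times the length of [I n]; the length undoes the normalisation of the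
   uniform law. *)
pose C : R := n.+1%:R * (n.+1%:R - - n.+1%:R).
have C0 : 0 < C by rewrite mulr_gt0 // subr_gt0.
apply: (@spectrum_primes_null_of_dominated R mu (uniform_prob NN) _ C) => //;
  last first.
  exact: inner_uniform_character.
(* With q = |g|^2, the chain is: the integral of q over [B n] for [mu] equals that for [kappa],
   hence that of q f for Lebesgue measure; f is then bounded by n+1 and [B n] enlarged to [I n]. *)
move=> g bg; pose q x := (sqnormc (g x))%:E.
have q0 x : (0 <= q x)%E by rewrite lee_fin sqnormc_ge0.
have mq : measurable_fun setT q.
  case: bg => [[m1 m2] _]; apply/measurable_EFinP.
  by apply: measurable_funD; exact: measurable_funX.
rewrite -lee_fin EFinM EFin_energy_cindicM // EFin_energy //.
rewrite -/q (@eq_measure_integral _ _ _ (B n) kappa); last first.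
  by move=> A mA AB; apply/esym/kappaE => x /AB[].
rewrite -(Radon_Nikodym_SigmaFinite.change_of_variables kleb) //;
  last exact: measurable_funTS.
have -> : (C%:E * \int[uniform_prob NN]_x q x =
    \int[leb]_(x in I n) (n.+1%:R%:E * q x))%E.
  rewrite integral_uniform // ge0_integralZl //; last exact: measurable_funTS.
  rewrite muleA -EFinM /C -mulrA mulfV ?mulr1 // gt_eqF // subr_gt0 //.
have mnq : measurable_fun setT (fun x => n.+1%:R%:E * q x)%E.
  exact: measurable_funeM.
apply: (@le_trans _ _ (\int[leb]_(x in B n) (n.+1%:R%:E * q x))%E).
  apply: ge0_le_integral => //.
  - by move=> x _; exact: mule_ge0 (q0 x) (f0 x).
  - by apply: measurable_funTS; exact: emeasurable_funM.
  - exact: measurable_funTS.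
  - by move=> x [_ [_ fx]]; rewrite [leRHS]muleC;
    exact: lee_wpmul2l (q0 x) _ _ fx.
apply: ge0_subset_integral => //.
- exact: measurable_funTS.
- by move=> x _; rewrite mule_ge0.
- by move=> x [_ []].
Qed.

End Main.

Theorem proposition1p4 (R : realType) (mu : probability (measurableTypeR R) R) :
  spectrum mu (primes_in R) -> singular_continuous mu.
Proof.
move=> specP; split; first exact: spectrum_primes_atomless.
exact: spectrum_primes_singular.
Qed.
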